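(* Let $\mathbf{k}$ be a unitary commutative ring and $\lambda\in\mathbf{k}$. Let $(R,d)$ be any differential $\mathbf{k}$-algebra of weight $\lambda$, and let $A$ be any $\mathbf{k}$-algebra. For any $\mathbf{k}$-algebra homomorphism $f:R\to A$, there is a unique morphism $\tilde f:(R,d)\to(DA,\partial_A)$ of differential $\mathbf{k}$-algebras of weight $\lambda$ such that $\varepsilon_A\circ\tilde f=f$ as $\mathbf{k}$-algebra homomorphisms $R\to A$.
   Context: Algebras are associative and unital, and algebra homomorphisms are unital. A differential $\mathbf{k}$-algebra of weight $\lambda$ is an associative $\mathbf{k}$-algebra $R$ with a $\mathbf{k}$-linear operator $d:R\to R$ such that $d(xy)=d(x)y+xd(y)+\lambda d(x)d(y)$ for all $x,y\in R$, and $d(1)=0$. A morphism $(R,d)\to(S,e)$ is a $\mathbf{k}$-algebra homomorphism $f$ with $f\circ d=e\circ f$. For a $\mathbf{k}$-algebra $A$, $DA$ (the algebra of $\lambda$-Hurwitz series over $A$) is the $\mathbf{k}$-module $A^{\mathbb{N}}$ of all functions $f:\mathbb{N}\to A$ ($\mathbb{N}=\{0,1,2,\dots\}$), with the $\lambda$-Hurwitz product $$(fg)(n)=\sum_{k=0}^{n}\sum_{j=0}^{n-k}\binom{n}{k}\binom{n-k}{j}\lambda^{k}f(n-j)g(k+j),$$ whose identity is the function with value $1_A$ at $0$ and value $0$ at all $n\neq 0$. The map $\partial_A:DA\to DA$ is $(\partial_A(f))(n)=f(n+1)$; the pair $(DA,\partial_A)$ is a differential $\mathbf{k}$-algebra of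 weight $\lambda$. The map $\varepsilon_A:DA\to A$ is the $\mathbf{k}$-algebra homomorphism $\varepsilon_A(f)=f(0)$. *)

(* Defs.v *)
From HB Require Import structures.
From mathcomp Require Import all_boot all_order all_algebra.
From mathcomp Require Import boolp functions.

Set Implicit Arguments.
Unset Strict Implicit.
Unset Printing Implicit Defensive.

Import GRing.Theory.
Local Open Scope ring_scope.

(* The library's [algType] extends [nzRingType], hence excludes the zero       *)
(* algebra (and every algebra over the zero ring); [kAlgebra] has the same     *)
(* axioms without the requirement 1 != 0.                                      *)
Record kAlgebra (k : comPzRingType) := KAlgebra {
  kalg_ring : pzRingType;
  kalg_scale : k -> kalg_ring -> kalg_ring;
  kalg_scaleA : forall a b x, kalg_scale a (kalg_scale b x) = kalg_scale (a * b) x;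
  kalg_scale1 : left_id 1 kalg_scale;
  kalg_scaleDr : right_distributive kalg_scale +%R;
  kalg_scaleDl : forall x, {morph kalg_scale^~ x : a b / a + b};
  kalg_scaleAl : forall a x y, kalg_scale a (x * y) = kalg_scale a x * y;
  kalg_scaleAr : forall a x y, kalg_scale a (x * y) = x * kalg_scale a y
}.

Definition kalg_sort (k : comPzRingType) (A : kAlgebra k) : Type := kalg_ring A.
Coercion kalg_sort : kAlgebra >-> Sortclass.

HB.instance Definition _ (k : comPzRingType) (A : kAlgebra k) :=
  GRing.PzRing.copy (kalg_sort A) (kalg_ring A).
HB.instance Definition _ (k : comPzRingType) (A : kAlgebra k) :=
  GRing.Zmodule_isLmodule.Build k (kalg_sort A)
    (@kalg_scaleA k A) (@kalg_scale1 k A) (@kalg_scaleDr k A) (@kalg_scaleDl k A).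

Lemma kscalerAl (k : comPzRingType) (A : kAlgebra k) (a : k) (x y : A) :
  a *: (x * y) = a *: x * y.
Proof. exact: kalg_scaleAl. Qed.

Lemma kscalerAr (k : comPzRingType) (A : kAlgebra k) (a : k) (x y : A) :
  a *: (x * y) = x * (a *: y).
Proof. exact: kalg_scaleAr. Qed.

Definition kAlgebra_of_algType (k : comPzRingType) (A : algType k) : kAlgebra k :=
  @KAlgebra k A *:%R (@scalerA k A) (@scale1r k A) (@scalerDr k A)
    (fun x a b => scalerDl x a b) (@scalerAl k A) (@scalerAr k A).

Definition is_alg_hom (k : comPzRingType) (A B : kAlgebra k) (f : A -> B) : Prop :=
  linear f /\ monoid_morphism f.

Record diffAlgebra (k : comPzRingType) (lam : k) := DiffAlgebra {
  diff_alg :> kAlgebra k;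
  diff_op : diff_alg -> diff_alg;
  diff_linear : linear diff_op;
  diff_mul : forall x y : diff_alg,
    diff_op (x * y) =
      diff_op x * y + x * diff_op y + lam *: (diff_op x * diff_op y);
  diff_one : diff_op 1 = 0
}.

Definition is_diff_hom (k : comPzRingType) (lam : k) (R S : diffAlgebra lam)
    (f : R -> S) : Prop :=
  is_alg_hom f /\ f \o @diff_op k lam R = @diff_op k lam S \o f.

(* An alias of [nat -> A]: it keeps the pointwise module structure, but not    *)
(* the pointwise product.                                                      *)
Definition hurwitz (k : comPzRingType) (lam : k) (A : kAlgebra k) : Type :=
  nat -> A.

HB.instance Definition _ (k : comPzRingType) (lam : k) (A : kAlgebra k) :=
  GRing.Lmodule.copy (hurwitz lam A) (nat -> A).

Section Hurwitz.
Variables (k : comPzRingType) (lam : k) (A : kAlgebra k).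
Implicit Types f g h : hurwitz lam A.

Definition hurwitz_mul f g : hurwitz lam A := fun n =>
  \sum_(i < n.+1) \sum_(j < (n - i).+1)
    (('C(n, i) * 'C(n - i, j))%:R * lam ^+ i) *: (f (n - j)%N * g (i + j)%N).

Definition hurwitz_one : hurwitz lam A := fun n => if n is 0 then 1 else 0.

Definition hurwitz_diff f : hurwitz lam A := fun n => f n.+1.

Definition hurwitz_eps f : A := f 0.

Lemma hurwitzP f g : (forall n, f n = g n) -> f = g.
Proof. exact: functional_extensionality_dep. Qed.

Lemma hurwitz_addE f g n : (f + g) n = f n + g n. Proof. by []. Qed.
Lemma hurwitz_scaleE a f n : (a *: f) n = a *: f n. Proof. by []. Qed.
Lemma hurwitz_zeroE n : (0 : hurwitz lam A) n = 0. Proof. by []. Qed.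

Let P n i j := ('C(n, i) * 'C(n - i, j))%N.

Let P_gt1 n i j : (n < i)%N -> P n i j = 0%N.
Proof. by move=> lt_ni; rewrite /P bin_small. Qed.

Let P_gt2 n i j : (n < j)%N -> P n i j = 0%N.
Proof.
by move=> lt_nj; rewrite /P ['C(_, j)]bin_small ?muln0 // (leq_ltn_trans (leq_subr _ _)).
Qed.

Let P_S n i j : P n.+1 i j =
  (P n i j + (if j is j'.+1 then P n i j' else 0)
           + (if i is i'.+1 then P n i' j else 0))%N.
Proof.
have aux m l j0 : (l <= m)%N -> ('C(m, l) * 'C(m.+1 - l, j0) =
   P m l j0 + (if j0 is j'.+1 then P m l j' else 0))%N.
  move=> le_lm; rewrite subSn // /P; case: j0 => [|j0]; first by rewrite !bin0 addn0.
  by rewrite binS mulnDr.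
case: i => [|i].
  rewrite addn0 -aux // /P !bin0; by [].
rewrite {1}/P subSS binS mulnDl; congr (_ + _)%N.
case: (ltnP n i.+1) => [lt_ni|le_in].
  rewrite bin_small // mul0n P_gt1 //; case: j => [|j] //; by rewrite P_gt1.
by rewrite -aux // subSS.
Qed.

Let S (N n : nat) (F : nat -> nat -> A) : A :=
  \sum_(i < N) \sum_(j < N) F i j *+ P n i j.

Let S_widen N n F : (n < N)%N -> S N.+1 n F = S N n F.
Proof.
move=> lt_nN; rewrite /S big_ord_recr /= [X in _ + X]big1 ?addr0 => [|j _]; last first.
  by rewrite P_gt1.
by apply: eq_bigr => i _; rewrite big_ord_recr /= P_gt2 // mulr0n addr0.
Qed.

Let S_rec N n F : (n < N)%N ->
  S N.+1 n.+1 F = S N n F + S N n (fun i j => F i j.+1) + S N n (fun i j => F i.+1 j).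
Proof.
move=> lt_nN; rewrite -(S_widen F lt_nN) {1}/S.
under eq_bigr => i _ do under eq_bigr => j _ do rewrite P_S !mulrnDr.
under eq_bigr => i _ do rewrite !big_split /=.
rewrite !big_split /=; congr (_ + _ + _).
  rewrite /S big_ord_recr /= [X in _ + X]big1 ?addr0 => [|[[|j] ltj] _] //=; last first.
    by rewrite P_gt1.
  by apply: eq_bigr => i _; rewrite big_ord_recl /= mulr0n add0r.
rewrite /S big_ord_recl /= big1 ?add0r => [|j _] //.
by apply: eq_bigr => i _; rewrite big_ord_recr /= P_gt2 // mulr0n addr0.
Qed.

Let mulE f g n :
  hurwitz_mul f g n = S n.+1 n (fun i j => lam ^+ i *: (f (n - j)%N * g (i + j)%N)).
Proof.
apply: eq_bigr => i _.
have le_in : ((n - i).+1 <= n.+1)%N by rewrite ltnS leq_subr.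
rewrite (big_ord_widen _ (fun j => (('C(n, i) * 'C(n - i, j))%:R * lam ^+ i) *:
  (f (n - j)%N * g (i + j)%N)) le_in) big_mkcond; apply: eq_bigr => j _.
case: ifP => [_|/negbT]; first by rewrite -scalerA scaler_nat.
by rewrite -leqNgt => lt_j; rewrite /P ['C(_ - _, j)]bin_small // muln0 mulr0n.
Qed.

Lemma hurwitz_eps_mul f g : hurwitz_mul f g 0%N = f 0%N * g 0%N.
Proof. by rewrite /hurwitz_mul !big_ord1 /= !bin0 expr0 mulr1 scale1r. Qed.

Lemma hurwitz_diff_mul f g :
  hurwitz_diff (hurwitz_mul f g) =
    hurwitz_mul (hurwitz_diff f) g + hurwitz_mul f (hurwitz_diff g)
    + lam *: hurwitz_mul (hurwitz_diff f) (hurwitz_diff g).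
Proof.
apply: hurwitzP => n; rewrite !hurwitz_addE hurwitz_scaleE /hurwitz_diff.
rewrite mulE (S_rec _ (ltnSn n)) !mulE; congr (_ + _ + _).
- by apply: eq_bigr => i _; apply: eq_bigr => j _; rewrite subSn // -ltnS.
- by apply: eq_bigr => i _; apply: eq_bigr => j _; rewrite subSS addnS.
rewrite /S scaler_sumr; apply: eq_bigr => i _; rewrite scaler_sumr.
apply: eq_bigr => j _.
by rewrite -scalerMnr scalerA -exprS subSn ?addSn // -ltnS.
Qed.

Lemma hurwitz_mulDl : left_distributive hurwitz_mul +%R.
Proof.
move=> f g h; apply: hurwitzP => n; rewrite hurwitz_addE -big_split /=.
apply: eq_bigr => i _; rewrite -big_split /=; apply: eq_bigr => j _.
by rewrite hurwitz_addE mulrDl scalerDr.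
Qed.

Lemma hurwitz_mulDr : right_distributive hurwitz_mul +%R.
Proof.
move=> f g h; apply: hurwitzP => n; rewrite hurwitz_addE -big_split /=.
apply: eq_bigr => i _; rewrite -big_split /=; apply: eq_bigr => j _.
by rewrite hurwitz_addE mulrDr scalerDr.
Qed.

Lemma hurwitz_scaleAl (a : k) f g : a *: hurwitz_mul f g = hurwitz_mul (a *: f) g.
Proof.
apply: hurwitzP => n; rewrite hurwitz_scaleE scaler_sumr; apply: eq_bigr => i _.
rewrite scaler_sumr; apply: eq_bigr => j _.
by rewrite hurwitz_scaleE -kscalerAl !scalerA mulrC.
Qed.

Lemma hurwitz_scaleAr (a : k) f g : a *: hurwitz_mul f g = hurwitz_mul f (a *: g).
Proof.
apply: hurwitzP => n; rewrite hurwitz_scaleE scaler_sumr; apply: eq_bigr => i _.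
rewrite scaler_sumr; apply: eq_bigr => j _.
by rewrite hurwitz_scaleE -kscalerAr !scalerA mulrC.
Qed.

Lemma hurwitz_diff_one : hurwitz_diff hurwitz_one = 0.
Proof. by apply: hurwitzP => n; rewrite hurwitz_zeroE. Qed.

Lemma hurwitz_mul0r f : hurwitz_mul 0 f = 0.
Proof. by rewrite -[X in hurwitz_mul X _](scale0r 0) -hurwitz_scaleAl scale0r. Qed.

Lemma hurwitz_mulr0 f : hurwitz_mul f 0 = 0.
Proof. by rewrite -[X in hurwitz_mul _ X](scale0r 0) -hurwitz_scaleAr scale0r. Qed.

Lemma hurwitz_mul1r : left_id hurwitz_one hurwitz_mul.
Proof.
move=> f; apply: hurwitzP => n; elim: n f => [|n IHn] f.
  by rewrite hurwitz_eps_mul mul1r.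
have -> : hurwitz_mul hurwitz_one f n.+1 = hurwitz_diff (hurwitz_mul hurwitz_one f) n by [].
rewrite hurwitz_diff_mul hurwitz_diff_one !hurwitz_mul0r scaler0 addr0 add0r.
exact: IHn.
Qed.

Lemma hurwitz_mulr1 : right_id hurwitz_one hurwitz_mul.
Proof.
move=> f; apply: hurwitzP => n; elim: n f => [|n IHn] f.
  by rewrite hurwitz_eps_mul mulr1.
have -> : hurwitz_mul f hurwitz_one n.+1 = hurwitz_diff (hurwitz_mul f hurwitz_one) n by [].
rewrite hurwitz_diff_mul hurwitz_diff_one !hurwitz_mulr0 scaler0 !addr0.
exact: IHn.
Qed.

Lemma hurwitz_mulA : associative hurwitz_mul.
Proof.
move=> f g h; apply: hurwitzP => n; elim: n f g h => [|n IHn] f g h.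
  by rewrite !hurwitz_eps_mul mulrA.
rewrite -![_ n.+1]/(hurwitz_diff _ n) !hurwitz_diff_mul.
rewrite !(hurwitz_mulDl, hurwitz_mulDr) -!(hurwitz_scaleAl, hurwitz_scaleAr).
rewrite !scalerDr !(hurwitz_addE, hurwitz_scaleE) !IHn -!addrA.
congr (_ + (_ + _)); rewrite [RHS]addrCA; congr (_ + _).
by rewrite addrCA; congr (_ + _); rewrite addrCA.
Qed.

Lemma hurwitz_diff_linear : linear hurwitz_diff.
Proof. by move=> a f g; apply: hurwitzP. Qed.

End Hurwitz.

HB.instance Definition _ (k : comPzRingType) (lam : k) (A : kAlgebra k) :=
  GRing.Zmodule_isPzRing.Build (hurwitz lam A)
    (@hurwitz_mulA k lam A) (@hurwitz_mul1r k lam A) (@hurwitz_mulr1 k lam A)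
    (@hurwitz_mulDl k lam A) (@hurwitz_mulDr k lam A).

Definition hurwitz_kAlgebra (k : comPzRingType) (lam : k) (A : kAlgebra k) :
    kAlgebra k :=
  @KAlgebra k (hurwitz lam A) *:%R (@scalerA k _) (@scale1r k _) (@scalerDr k _)
    (fun f a b => scalerDl f a b)
    (@hurwitz_scaleAl k lam A) (@hurwitz_scaleAr k lam A).

Definition hurwitz_diffAlgebra (k : comPzRingType) (lam : k) (A : kAlgebra k) :
    diffAlgebra lam :=
  @DiffAlgebra k lam (hurwitz_kAlgebra lam A) (@hurwitz_diff k lam A)
    (@hurwitz_diff_linear k lam A) (@hurwitz_diff_mul k lam A)
    (@hurwitz_diff_one k lam A).

Lemma hurwitz_eps_alg_hom (k : comPzRingType) (lam : k) (A : kAlgebra k) :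
  @is_alg_hom k (hurwitz_kAlgebra lam A) A (@hurwitz_eps k lam A).
Proof. by split=> //; split=> // f g; exact: hurwitz_eps_mul. Qed.

(* Main.v *)
Require Import Defs.
From HB Require Import structures.
From mathcomp Require Import all_boot all_order all_algebra.
From mathcomp Require Import boolp.

(** The condition on [d] forces the lift to send [x] to the sequence of the
    [f (d^n x)].  Multiplicativity of this lift is proved by induction on the
    index: [d] and the shift obey the same Leibniz rule of weight [lam], which
    turns the claim at [n + 1] for [(x, y)] into the claims at [n] for
    [(d x, y)], [(x, d y)] and [(d x, d y)]. *)

Import GRing.Theory.
Local Open Scope ring_scope.

Section HurwitzLift.
Variables (k : comPzRingType) (lam : k) (R : diffAlgebra lam) (A : kAlgebra k).
Variable f : R -> A.

Let d : R -> R := @diff_op k lam R.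

Definition hurwitz_lift (x : R) : hurwitz lam A := fun n => f (iter n d x).

Lemma hurwitz_lift_diff (x : R) :
  hurwitz_lift (d x) = @hurwitz_diff k lam A (hurwitz_lift x).
Proof. by apply: hurwitzP => n; rewrite /hurwitz_diff /hurwitz_lift iterSr. Qed.

Lemma iter_diff_linear (n : nat) : linear (iter n d).
Proof.
by elim: n => [|n IHn] a x y //; rewrite !iterS IHn; apply: diff_linear.
Qed.

Hypothesis hf : is_alg_hom f.

Lemma hurwitz_lift_linear : linear hurwitz_lift.
Proof.
move=> a x y; apply: hurwitzP => n.
rewrite hurwitz_addE hurwitz_scaleE /hurwitz_lift iter_diff_linear.
exact: hf.1.
Qed.

Lemma hurwitz_lift_one : hurwitz_lift 1 = @hurwitz_one k lam A.
Proof.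
(* Linearity at scalar [-1] and zero vectors reads [f 0 = - f 0 + f 0]; the same trick serves
   [d]. *)
have f0 : f 0 = 0 by have := hf.1 (-1) 0 0; rewrite !scaleN1r !addNr.
have d0 : d 0 = 0.
  by have := @diff_linear k lam R (-1) 0 0; rewrite !scaleN1r !addNr.
apply: hurwitzP => -[|n]; first exact: hf.2.1.
rewrite /hurwitz_lift iterSr [d 1]diff_one.
by elim: n => //= n IHn; rewrite -iterS iterSr d0.
Qed.

Lemma hurwitz_lift_mul (x y : R) :
  hurwitz_lift (x * y) = hurwitz_mul (hurwitz_lift x) (hurwitz_lift y).
Proof.
apply: hurwitzP => n; elim: n x y => [|n IHn] x y.
  by rewrite hurwitz_eps_mul; apply: hf.2.2.
rewrite -![_ n.+1]/(@hurwitz_diff k lam A _ n) -hurwitz_lift_diff.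
rewrite hurwitz_diff_mul -!hurwitz_lift_diff [d (x * y)]diff_mul -/d.
(* Putting the [lam] term first, then giving [d x * y] the scalar 1, fits both sums to the shape
   [a *: u + v] of [linear]. *)
rewrite addrC hurwitz_lift_linear -[d x * y]scale1r hurwitz_lift_linear scale1r.
by rewrite !(hurwitz_addE, hurwitz_scaleE) !IHn addrC.
Qed.

End HurwitzLift.

Theorem corollary2p8 (k : comPzRingType) (lam : k) (R : diffAlgebra lam)
    (A : kAlgebra k) (f : R -> A) (hf : is_alg_hom f) :
  exists! g : R -> hurwitz_diffAlgebra lam A,
    is_diff_hom g /\ @hurwitz_eps k lam A \o g = f.
Proof.
exists (@hurwitz_lift k lam R A f); split.
  split=> //; split; last first.
    by apply: funext => x /=; apply: hurwitz_lift_diff.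
  split; first exact: hurwitz_lift_linear.
  by split; [exact: hurwitz_lift_one | exact: hurwitz_lift_mul].
move=> g [[_ g_diff] g_eps]; apply: funext => x; apply: hurwitzP => n.
have g_d y : g (diff_op y) = @hurwitz_diff k lam A (g y).
  exact: (congr1 (@^~ y) g_diff).
(* Uniqueness: [g_eps] fixes the entry at 0, and [g_d] makes entry [n.+1] of [g x] the entry [n] of
   [g (d x)], with [d] the operator of [R]; hence the induction keeps [x] general. *)
elim: n x => [|n IHn] x; first by rewrite -g_eps.
by rewrite -[RHS]/(@hurwitz_diff k lam A (g x) n) -g_d -IHn /hurwitz_lift iterSr.
Qed.
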